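(* Let $(R,\mathfrak{m})$ be a Noetherian local ring, $T$ an $R$-algebra equipped with a value map $v$, $M$ an almost Cohen-Macaulay $T$-module over $R$ (with respect to $v$), and let $\underline{x}=x_1,\ldots,x_r$ be a generating set for $\mathfrak{m}$. Then $H^{\dim R}_{\underline{x}}(M)$ is not almost zero with respect to $v$.
   Context: All rings and algebras are commutative. $H^i_{\underline{x}}(M)$ denotes the $i$-th cohomology module of the Čech complex $0\to M\to\bigoplus_i M_{x_i}\to\cdots\to M_{x_1\cdots x_r}\to 0$ (with $M$ in degree $0$). An algebra $T$ over $(R,\mathfrak{m})$ is equipped with a value map $v$ if $v:T\to\mathbb{R}\cup\{\infty\}$ is a map satisfying: (a) $v(ab)=v(a)+v(b)$ for all $a,b\in T$; (b) $v(a+b)\ge\min\{v(a),v(b)\}$ for all $a,b\in T$; (c) $v(a)=\infty$ if and only if $a=0$. A $T$-module $N$ is almost zero with respect to $v$ if for every $m\in N$ and every $\epsilon>0$ there exists $b\in T$ with $b\cdot m=0$ and $v(b)<\epsilon$. A $T$-module $N$ is almost Cohen-Macaulay over $R$ if, for a generating set $\underline{x}=x_1,\ldots,x_r$ of $\mathfrak{m}$, $H^i_{\underline{x}}(N)$ is almost zero with respect to $v$ for all $i\ne\dim R$, but $N/\mathfrak{m}N$ is not almost zero with respect to $v$. (Up to isomorphism $H^i_{\underline{x}}(N)$ does not depend on the choice of the finite generating set of $\mathfrak{m}$.) *)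

(* Defs.v *)
From HB Require Import structures.
From mathcomp Require Import all_boot all_order all_algebra.
From mathcomp Require Import generic_quotient ring_quotient.
From mathcomp Require Import boolp classical_sets reals constructive_ereal.
From mathcomp Require Import zify.

Set Implicit Arguments.
Unset Strict Implicit.
Unset Printing Implicit Defensive.

Import Order.TTheory GRing.Theory Num.Theory.

Local Open Scope ring_scope.
Local Open Scope quotient_scope.

(* [idealr R] is MathComp's type of proper ideals of R, [prime_idealr R] its
   type of prime ideals. *)
Section LocalRings.
Variable R : comNzRingType.

Definition generates (r : nat) (x : 'I_r -> R) (I : {pred R}) : Prop :=
  forall a, a \in I <-> exists c : 'I_r -> R, a = \sum_(i < r) c i * x i.

(* The unit ideal is generated by 1, so it suffices to consider proper ideals. *)
Definition noetherian : Prop :=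
  forall I : idealr R, exists (r : nat) (x : 'I_r -> R), generates x I.

Definition maximal_ideal (I : idealr R) : Prop :=
  forall J : idealr R, {subset I <= J} -> J =i I.

Definition local_ring (m : idealr R) : Prop :=
  maximal_ideal m /\ forall n : idealr R, maximal_ideal n -> n =i m.

Definition prime_chain (n : nat) (P : 'I_n.+1 -> prime_idealr R) : Prop :=
  forall i j : 'I_n.+1, (i < j)%N ->
    {subset P i <= P j} /\ ~ {subset P j <= P i}.

Definition has_krull_dim (d : nat) : Prop :=
  (exists P : 'I_d.+1 -> prime_idealr R, prime_chain P) /\
  (forall (n : nat) (P : 'I_n.+1 -> prime_idealr R),
     prime_chain P -> (n <= d)%N).

(* The supremum of the lengths of chains of primes.  It is finite for a
   Noetherian local ring; the default value 0 is only taken when the lengths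
   are unbounded. *)
Definition krull_dim : nat := xget 0%N [set d | has_krull_dim d].

End LocalRings.

Section QuotientModule.
Variables (T : pzRingType) (V : lmodType T) (S : submodClosed V).

(* [Quotient.quot] needs a [zmodClosed] predicate, but MathComp's [submodClosed]
   does not record the closure under opposite that the scalar -1 provides. *)
Definition submod_zmod : {pred V} := S.

Fact submod_zmod_closed : zmod_closed submod_zmod.
Proof. exact: GRing.subsemimod_closedB (GRing.subsemimodClosedP S). Qed.

HB.instance Definition _ := GRing.isZmodClosed.Build V submod_zmod
  submod_zmod_closed.

Definition quotmod := Quotient.quot submod_zmod.

HB.instance Definition _ := GRing.Zmodule.on quotmod.
HB.instance Definition _ := ZmodQuotient.on quotmod.

Definition quotmod_scale (a : T) (u : quotmod) : quotmod :=
  \pi_quotmod (a *: repr u).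

Lemma quotmod_eqE (x y : V) : (x == y %[mod quotmod]) = (x - y \in S).
Proof. by rewrite -Quotient.idealrBE. Qed.

Lemma quotmod_pi_scale a (x : V) :
  quotmod_scale a (\pi_quotmod x) = \pi_quotmod (a *: x).
Proof.
apply/eqP; rewrite quotmod_eqE -scalerBr.
by apply: (@rpredZ _ _ S); rewrite -quotmod_eqE reprK.
Qed.

Lemma quotmod_piD (x y : V) :
  \pi_quotmod (x + y) = \pi_quotmod x + \pi_quotmod y.
Proof. exact: Quotient.pi_add. Qed.

Fact quotmod_scalerA a b u :
  quotmod_scale a (quotmod_scale b u) = quotmod_scale (a * b) u.
Proof.
elim/quotW: u => x.
by rewrite (quotmod_pi_scale b) !quotmod_pi_scale scalerA.
Qed.

Fact quotmod_scale1r : left_id 1 quotmod_scale.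
Proof. by elim/quotW=> x; rewrite quotmod_pi_scale scale1r. Qed.

Fact quotmod_scalerDr : right_distributive quotmod_scale +%R.
Proof.
move=> a; elim/quotW=> x; elim/quotW=> y.
by rewrite -quotmod_piD !quotmod_pi_scale -quotmod_piD scalerDr.
Qed.

Fact quotmod_scalerDl u : {morph quotmod_scale^~ u : a b / a + b}.
Proof.
move=> a b; elim/quotW: u => x.
by rewrite !quotmod_pi_scale scalerDl quotmod_piD.
Qed.

HB.instance Definition _ := GRing.Zmodule_isLmodule.Build T quotmod
  quotmod_scalerA quotmod_scale1r quotmod_scalerDr quotmod_scalerDl.

End QuotientModule.

Section Localization.
Variables (T : comPzRingType) (M : lmodType T) (t : T).

(* The pair (m, k) stands for the fraction m / t^k. *)
Definition loc_equiv (p q : M * nat) : bool :=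
  `[< exists n, t ^+ n *: (t ^+ q.2 *: p.1) = t ^+ n *: (t ^+ p.2 *: q.1) >].

Lemma loc_equiv_is_equiv : equiv_class_of loc_equiv.
Proof.
split=> [[m k]|[m k] [n l]|[n l] [m k] [q j]]; rewrite /loc_equiv /=.
- by apply/asboolP; exists 0%N.
- by apply/asboolP/asboolP => -[N e]; exists N.
move=> /asboolP[N eN] /asboolP[P eP]; apply/asboolP; exists (N + P + l)%N.
rewrite !scalerA -!exprD in eN eP *.
have -> : (N + P + l + j = (P + j) + (N + l))%N by lia.
rewrite exprD -scalerA eN scalerA -exprD.
have -> : (P + j + (N + k) = (N + k) + (P + j))%N by lia.
rewrite exprD -scalerA eP scalerA -exprD.
by congr (t ^+ _ *: _); lia.
Qed.

Canonical loc_equiv_equiv := EquivRelPack loc_equiv_is_equiv.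
Canonical loc_encModRel := defaultEncModRel loc_equiv.

Definition loc := {eq_quot loc_equiv}.
HB.instance Definition _ := Choice.on loc.
HB.instance Definition _ : EqQuotient _ loc_equiv loc := EqQuotient.on loc.

Definition frac (m : M) (k : nat) : loc := \pi_loc (m, k).

Lemma frac_eqP m k n l :
  frac m k = frac n l <->
  exists N, t ^+ N *: (t ^+ l *: m) = t ^+ N *: (t ^+ k *: n).
Proof.
rewrite /frac; split=> [/eqP|e]; first by rewrite piE => /asboolP.
by apply/eqP; rewrite piE; apply/asboolP.
Qed.

Lemma loc_ind (Q : loc -> Prop) :
  (forall m k, Q (frac m k)) -> forall z, Q z.
Proof. by move=> H z; rewrite -[z]reprK; case: (repr z) => m k; apply: H. Qed.

Lemma frac_repr (z : loc) : frac (repr z).1 (repr z).2 = z.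
Proof. by rewrite /frac -surjective_pairing reprK. Qed.

Definition loc_zero : loc := frac 0 0.
Definition loc_opp (z : loc) : loc := frac (- (repr z).1) (repr z).2.
Definition loc_add (z w : loc) : loc :=
  frac (t ^+ (repr w).2 *: (repr z).1 + t ^+ (repr z).2 *: (repr w).1)
       ((repr z).2 + (repr w).2).
Definition loc_scale (a : T) (z : loc) : loc := frac (a *: (repr z).1) (repr z).2.

Lemma loc_oppE m k : loc_opp (frac m k) = frac (- m) k.
Proof.
rewrite /loc_opp; have /frac_eqP[N e] := frac_repr (frac m k).
by apply/frac_eqP; exists N; rewrite !scalerN e.
Qed.

Lemma loc_scaleE a m k : loc_scale a (frac m k) = frac (a *: m) k.
Proof.
rewrite /loc_scale; have /frac_eqP[N e] := frac_repr (frac m k).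
apply/frac_eqP; exists N; rewrite !scalerA in e *.
by rewrite ![_ * a]mulrC -scalerA e scalerA.
Qed.

Lemma loc_addE m k n l :
  loc_add (frac m k) (frac n l) = frac (t ^+ l *: m + t ^+ k *: n) (k + l).
Proof.
rewrite /loc_add.
have := frac_repr (frac m k); case: (repr _) => m' k' /= /frac_eqP[N eN].
have := frac_repr (frac n l); case: (repr _) => n' l' /= /frac_eqP[P eP].
apply/frac_eqP; exists (N + P)%N.
rewrite !scalerDr !scalerA -!exprD in eN eP *; congr (_ + _).
  have -> : (N + P + (k + l) + l' = P + l + l' + (N + k))%N by lia.
  rewrite exprD -scalerA eN scalerA -exprD.
  by congr (t ^+ _ *: _); lia.
have -> : (N + P + (k + l) + k' = N + k + k' + (P + l))%N by lia.
rewrite exprD -scalerA eP scalerA -exprD.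
by congr (t ^+ _ *: _); lia.
Qed.

Fact loc_addA : associative loc_add.
Proof.
elim/loc_ind=> m k; elim/loc_ind=> n l; elim/loc_ind=> q j.
rewrite !loc_addE addnA !scalerDr !scalerA -!exprD addrA.
by rewrite [(l + j)%N]addnC [(j + k)%N]addnC.
Qed.

Fact loc_addC : commutative loc_add.
Proof.
by elim/loc_ind=> m k; elim/loc_ind=> n l; rewrite !loc_addE addrC addnC.
Qed.

Fact loc_add0 : left_id loc_zero loc_add.
Proof.
by elim/loc_ind=> m k; rewrite loc_addE scaler0 add0r expr0 scale1r.
Qed.

Fact loc_addN : left_inverse loc_zero loc_opp loc_add.
Proof.
elim/loc_ind=> m k; rewrite loc_oppE loc_addE scalerN addNr.
by apply/frac_eqP; exists 0%N; rewrite !scaler0.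
Qed.

HB.instance Definition _ :=
  GRing.isZmodule.Build loc loc_addA loc_addC loc_add0 loc_addN.

Fact loc_scalerA a b z : loc_scale a (loc_scale b z) = loc_scale (a * b) z.
Proof. by elim/loc_ind: z => m k; rewrite !loc_scaleE scalerA. Qed.

Fact loc_scale1r : left_id 1 loc_scale.
Proof. by elim/loc_ind=> m k; rewrite loc_scaleE scale1r. Qed.

Fact loc_scalerDr : right_distributive loc_scale +%R.
Proof.
move=> a; elim/loc_ind=> m k; elim/loc_ind=> n l.
rewrite [_ + _]loc_addE !loc_scaleE [RHS]loc_addE.
by rewrite scalerDr !scalerA ![a * _]mulrC.
Qed.

Fact loc_scalerDl z : {morph loc_scale^~ z : a b / a + b}.
Proof.
move=> a b /=; elim/loc_ind: z => m k; rewrite !loc_scaleE [RHS]loc_addE.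
apply/frac_eqP; exists 0%N; rewrite !expr0 !scale1r.
by rewrite exprD -scalerA -scalerDr -scalerDl.
Qed.

HB.instance Definition _ := GRing.Zmodule_isLmodule.Build T loc
  loc_scalerA loc_scale1r loc_scalerDr loc_scalerDl.

Lemma fracD m k n l :
  frac m k + frac n l = frac (t ^+ l *: m + t ^+ k *: n) (k + l).
Proof. exact: loc_addE. Qed.

Lemma fracZ a m k : a *: frac m k = frac (a *: m) k.
Proof. exact: loc_scaleE. Qed.

End Localization.

Section LocalizationMap.
Variables (T : comPzRingType) (M : lmodType T) (t h u : T).

(* For u = h * t, the canonical map M_t -> M_u, m / t^k |-> h^k m / u^k. *)
Definition loc_map (z : loc M t) : loc M u :=
  frac u (h ^+ (repr z).2 *: (repr z).1) (repr z).2.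

Hypothesis uE : u = h * t.

Lemma loc_mapE m k : loc_map (frac t m k) = frac u (h ^+ k *: m) k.
Proof.
rewrite /loc_map; have := frac_repr (frac t m k).
case: (repr _) => n l /= /frac_eqP[N e]; apply/frac_eqP; exists N.
rewrite !scalerA -!exprD uE !exprMn in e *.
have -> : h ^+ (N + k) * t ^+ (N + k) * h ^+ l =
          h ^+ (N + k + l) * t ^+ (N + k) by rewrite (exprD h (N + k)) mulrAC.
rewrite -scalerA e scalerA mulrAC -exprD.
by congr (h ^+ _ * _ *: _); lia.
Qed.

Lemma loc_map_linear : linear loc_map.
Proof.
move=> a; elim/loc_ind=> m k; elim/loc_ind=> n l.
rewrite fracZ fracD !loc_mapE fracZ fracD; congr (frac u _ _).
rewrite scalerDr !scalerA uE !exprMn !exprD; congr (_ *: _ + _ *: _).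
  by rewrite -!mulrA mulrC -!mulrA.
by rewrite mulrAC.
Qed.

End LocalizationMap.

Lemma loc_map_comp (T : comPzRingType) (M : lmodType T) (t h u g w : T)
    (uE : u = h * t) (wE : w = g * u) (z : loc M t) :
  loc_map g w (loc_map h u z) = loc_map (g * h) w z.
Proof.
elim/loc_ind: z => m k; rewrite (loc_mapE uE) (loc_mapE wE).
by rewrite loc_mapE ?wE ?uE ?mulrA // scalerA exprMn.
Qed.

Section Cech.
Variables (T : comPzRingType) (r : nat) (x : 'I_r -> T) (M : lmodType T).

Definition cech_prod (S : {set 'I_r}) : T := \prod_(i in S) x i.

(* The direct sum of all terms of the Cech complex; its term of degree p is the
   direct sum of the localizations indexed by the subsets with p elements.  For
   p = 0 this is the localization of M at the empty product 1, that is, M. *)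
Definition cech : Type := forall S : {set 'I_r}, loc M (cech_prod S).

HB.instance Definition _ := Choice.copy cech
  (forall S : {set 'I_r}, loc M (cech_prod S)).

Definition cech_zero : cech := fun=> 0.
Definition cech_opp (c : cech) : cech := fun S => - c S.
Definition cech_add (c e : cech) : cech := fun S => c S + e S.
Definition cech_scale (a : T) (c : cech) : cech := fun S => a *: c S.

Fact cech_addA : associative cech_add.
Proof. by move=> c e g; apply: functional_extensionality_dep => S; apply: addrA. Qed.
Fact cech_addC : commutative cech_add.
Proof. by move=> c e; apply: functional_extensionality_dep => S; apply: addrC. Qed.
Fact cech_add0 : left_id cech_zero cech_add.
Proof. by move=> c; apply: functional_extensionality_dep => S; apply: add0r. Qed.
Fact cech_addN : left_inverse cech_zero cech_opp cech_add.
Proof. by move=> c; apply: functional_extensionality_dep => S; apply: addNr. Qed.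

HB.instance Definition _ :=
  GRing.isZmodule.Build cech cech_addA cech_addC cech_add0 cech_addN.

Fact cech_scalerA a b c : cech_scale a (cech_scale b c) = cech_scale (a * b) c.
Proof. by apply: functional_extensionality_dep => S; apply: scalerA. Qed.
Fact cech_scale1r : left_id 1 cech_scale.
Proof. by move=> c; apply: functional_extensionality_dep => S; apply: scale1r. Qed.
Fact cech_scalerDr : right_distributive cech_scale +%R.
Proof. by move=> a c e; apply: functional_extensionality_dep => S; apply: scalerDr. Qed.
Fact cech_scalerDl c : {morph cech_scale^~ c : a b / a + b}.
Proof. by move=> a b; apply: functional_extensionality_dep => S; apply: scalerDl. Qed.

HB.instance Definition _ := GRing.Zmodule_isLmodule.Build T cech
  cech_scalerA cech_scale1r cech_scalerDr cech_scalerDl.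

Definition cech_sign (i : 'I_r) (S : {set 'I_r}) : T :=
  (-1) ^+ #|[set j in S | (j < i)%N]|.

Definition cech_d (c : cech) : cech := fun S =>
  \sum_(i in S) cech_sign i S *: loc_map (x i) (cech_prod S) (c (S :\ i)).

Lemma cech_prodD1 (S : {set 'I_r}) i :
  i \in S -> cech_prod S = x i * cech_prod (S :\ i).
Proof. by move=> iS; rewrite /cech_prod (big_setD1 i). Qed.

Lemma cech_d_linear : linear cech_d.
Proof.
move=> a c e; apply: functional_extensionality_dep => S.
rewrite /cech_d; transitivity
  (a *: (\sum_(i in S) cech_sign i S *: loc_map (x i) (cech_prod S) (c (S :\ i)))
   + \sum_(i in S) cech_sign i S *: loc_map (x i) (cech_prod S) (e (S :\ i)));
  last by [].
rewrite scaler_sumr -big_split /=; apply: eq_bigr => i iS.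
rewrite (loc_map_linear (cech_prodD1 iS)) scalerDr !scalerA.
by rewrite [a * _]mulrC.
Qed.

HB.instance Definition _ := GRing.isLinear.Build T cech cech _ cech_d cech_d_linear.

Lemma cech_sign_swap (S : {set 'I_r}) i j : i \in S -> j \in S -> (i < j)%N ->
  cech_sign j S * cech_sign i (S :\ j) =
  - (cech_sign i S * cech_sign j (S :\ i)).
Proof.
move=> iS jS ij; rewrite /cech_sign.
have -> : [set k in S :\ j | (k < i)%N] = [set k in S | (k < i)%N].
  apply/setP => k; rewrite !inE; case: eqP => // ->.
  by rewrite [(j < i)%N]ltnNge (ltnW ij) /= andbF.
have -> : [set k in S :\ i | (k < j)%N] = [set k in S | (k < j)%N] :\ i.
  by apply/setP => k; rewrite !inE andbA.
rewrite (cardsD1 i [set k in S | (k < j)%N]) inE iS ij /=.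
by rewrite add1n exprS mulN1r mulNr mulrC.
Qed.

Lemma cech_dd c : cech_d (cech_d c) = 0.
Proof.
apply: functional_extensionality_dep => S.
pose F i j := (cech_sign i S * cech_sign j (S :\ i)) *:
  loc_map (x i * x j) (cech_prod S) (c (S :\ i :\ j)).
transitivity (\sum_(i in S) \sum_(j in S :\ i) F i j).
  apply: eq_bigr => i iS.
  have lin := loc_map_linear (M := M) (cech_prodD1 iS).
  pose L : {linear _ -> _} := HB.pack (loc_map (M := M) (x i) (cech_prod S))
    (GRing.isLinear.Build _ _ _ _ _ lin).
  rewrite -[loc_map _ _ _]/(L (cech_d c (S :\ i))) linear_sum scaler_sumr.
  apply: eq_bigr => j jS; rewrite linearZ /= scalerA /F.
  by rewrite (loc_map_comp (cech_prodD1 jS) (cech_prodD1 iS)).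
have FN i j : i \in S -> j \in S -> (i < j)%N -> F j i = - F i j.
  move=> iS jS ij; rewrite /F cech_sign_swap // scaleNr; congr (- (_ *: _)).
  by rewrite !finset.setDDl [in LHS]finset.setUC [in LHS]mulrC.
have -> : \sum_(i in S) \sum_(j in S :\ i) F i j =
  \sum_(i in S) \sum_(j in S | (i < j)%N) F i j +
  \sum_(i in S) \sum_(j in S | (j < i)%N) F i j.
  rewrite -big_split /=; apply: eq_bigr => i iS.
  rewrite (bigID (fun j : 'I_r => (i < j)%N)) /=; congr (_ + _);
    apply: eq_bigl => j; rewrite !inE -val_eqE /=;
    by case: (ltngtP i j); rewrite ?andbT ?andbF.
rewrite [X in _ + X](exchange_big_dep (mem S)) /=; last by move=> i j _ /andP[].
rewrite -big_split /= big1 // => i iS.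
rewrite [X in _ + X](eq_bigl (fun j => (j \in S) && (i < j)%N)); last first.
  by move=> j; rewrite iS.
by rewrite -big_split /= big1 // => j /andP[jS ij]; rewrite (FN i j) // subrr.
Qed.

Definition cech_deg (p : nat) (c : cech) : Prop :=
  forall S : {set 'I_r}, #|S| <> p -> c S = 0.

Definition cocycle (p : nat) : {pred cech} :=
  [pred c | `[< cech_deg p c /\ cech_d c = 0 >]].

Fact cocycle_closed p : subsemimod_closed (cocycle p).
Proof.
split; first split.
- by apply/asboolP; split=> // ; rewrite linear0.
- move=> c e /asboolP[c0 dc] /asboolP[e0 de]; apply/asboolP; split.
    by move=> S nS; rewrite -[LHS]/(c S + e S) c0 // e0 // addr0.
  by rewrite linearD /= dc de addr0.
- move=> a c /asboolP[c0 dc]; apply/asboolP; split.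
    by move=> S nS; rewrite -[LHS]/(a *: c S) c0 // scaler0.
  by rewrite linearZ /= dc scaler0.
Qed.

HB.instance Definition _ p :=
  GRing.isSubmodClosed.Build T cech (cocycle p) (cocycle_closed p).

Record cocycles (p : nat) :=
  Cocycles { cochain : cech; cochainP : cochain \in cocycle p }.

HB.instance Definition _ p := [isSub for @cochain p].
HB.instance Definition _ p := [Choice of cocycles p by <:].
HB.instance Definition _ p := [SubChoice_isSubLmodule of cocycles p by <:].

(* The images under cech_d of the cochains of degree p - 1; for p = 0, no
   subset has p - 1 elements and only 0 is a coboundary. *)
Definition coboundary (p : nat) : {pred cocycles p} :=
  [pred z | `[< exists b : cech,
      (forall S : {set 'I_r}, #|S|.+1 <> p -> b S = 0) /\ val z = cech_d b >]].

Fact coboundary_closed p : subsemimod_closed (@coboundary p).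
Proof.
split; first split.
- by apply/asboolP; exists 0; rewrite !linear0.
- move=> y z /asboolP[b [b0 yb]] /asboolP[e [e0 ze]]; apply/asboolP.
  exists (b + e); split; last by rewrite !linearD /= yb ze.
  by move=> S nS; rewrite -[LHS]/(b S + e S) b0 // e0 // addr0.
- move=> a y /asboolP[b [b0 yb]]; apply/asboolP.
  exists (a *: b); split; last by rewrite !linearZ /= yb.
  by move=> S nS; rewrite -[LHS]/(a *: b S) b0 // scaler0.
Qed.

HB.instance Definition _ p :=
  GRing.isSubmodClosed.Build T (cocycles p) (@coboundary p) (coboundary_closed p).

Definition cech_cohomology (p : nat) : lmodType T := quotmod (@coboundary p).

End Cech.

Section IdealMultiple.
Variables (R : comNzRingType) (T : comPzRingType) (f : {rmorphism R -> T}).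
Variables (I : idealr R) (M : lmodType T).

Definition ideal_mul : {pred M} :=
  [pred y | `[< exists (n : nat) (a : 'I_n -> R) (z : 'I_n -> M),
      (forall i, a i \in I) /\ y = \sum_(i < n) f (a i) *: z i >]].

Fact ideal_mul_closed : subsemimod_closed ideal_mul.
Proof.
split; first split.
- apply/asboolP; exists 0%N, (fun=> 0), (fun=> 0).
  by split=> [[]|]; rewrite // big_ord0.
- move=> y w /asboolP[n [a [z [aI ->]]]] /asboolP[n' [a' [z' [aI' ->]]]].
  apply/asboolP; exists (n + n')%N.
  exists (fun i => match split i with inl j => a j | inr j => a' j end).
  exists (fun i => match split i with inl j => z j | inr j => z' j end).
  split=> [i|]; first by case: (split i).
  rewrite big_split_ord /=; congr (_ + _); apply: eq_bigr => i _.
    by rewrite (unsplitK (inl i)).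
  by rewrite (unsplitK (inr i)).
- move=> b y /asboolP[n [a [z [aI ->]]]]; apply/asboolP.
  exists n, a, (fun i => b *: z i); split=> //.
  by rewrite scaler_sumr; apply: eq_bigr => i _; rewrite !scalerA mulrC.
Qed.

HB.instance Definition _ :=
  GRing.isSubmodClosed.Build T M ideal_mul ideal_mul_closed.

Definition mod_ideal : lmodType T := quotmod ideal_mul.

End IdealMultiple.

Section AlmostCohenMacaulay.
Variables (K : realType) (R : comNzRingType) (T : comPzRingType).

(* K plays the role of the field of real numbers; v takes values in K and +oo. *)
Definition value_map (v : T -> \bar K) : Prop :=
  [/\ forall a, v a <> -oo%E,
      forall a b, v (a * b) = (v a + v b)%E,
      forall a b, (mine (v a) (v b) <= v (a + b)%R)%E
    & forall a, v a = +oo%E <-> a = 0].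

Definition almost_zero (v : T -> \bar K) (N : lmodType T) : Prop :=
  forall (n : N) (eps : K), 0 < eps ->
    exists b : T, b *: n = 0 /\ (v b < eps%:E)%E.

(* The R-algebra structure of T is the ring morphism f, and x_i acts on
   T-modules as f (x_i). *)
Definition almost_cohen_macaulay (f : {rmorphism R -> T}) (m : idealr R)
    (v : T -> \bar K) (N : lmodType T) : Prop :=
  (exists (r : nat) (x : 'I_r -> R), generates x m /\
     forall i : nat, i <> krull_dim R ->
       almost_zero v (cech_cohomology (f \o x) N i)) /\
  ~ almost_zero v (mod_ideal f m N).

End AlmostCohenMacaulay.

(* Main.v *)
(* Suppose the top cohomology is almost zero as well.  Enlarging a sequence by
   elements of the ideal it generates preserves almost vanishing of Cech
   cohomology, so, writing y for the sequence provided by the almost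
   Cohen-Macaulay hypothesis, all the Cech cohomology of M on the concatenation
   z of x and y is almost zero: use y for the degrees other than dim R and x for
   dim R.  Now tensor the Cech complex with the Koszul complex of z: the elements
   m / (product of the z_i, i in A), placed at the index A of both complexes,
   form a cycle of the total complex which starts with m.  As the Cech direction
   is almost exact, almost this cycle is a boundary, which puts a multiple of m
   by an element of small value in zM.  So M/mM is almost zero, a contradiction. *)

Require Import Defs.
From HB Require Import structures.
From mathcomp Require Import all_boot all_order all_algebra.
From mathcomp Require Import ring_quotient boolp reals constructive_ereal.
From mathcomp Require Import generic_quotient zify.

Set Implicit Arguments.
Unset Strict Implicit.
Unset Printing Implicit Defensive.

Import Order.TTheory GRing.Theory Num.Theory.

Local Open Scope ring_scope.
Local Open Scope quotient_scope.

Local Notation frac := Defs.frac.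

(** * Antisymmetric double sums and radicals of ideals *)

Lemma sum_antisym (V : zmodType) (n : nat) (G : 'I_n -> 'I_n -> V) :
  (forall i, G i i = 0) ->
  (forall i j : 'I_n, (i < j)%N -> G j i = - G i j) ->
  \sum_i \sum_j G i j = 0.
Proof.
move=> G0 GN.
have -> : \sum_i \sum_j G i j =
    \sum_(i < n) \sum_(j < n | (i < j)%N) G i j +
    \sum_(i < n) \sum_(j < n | (j < i)%N) G i j.
  rewrite -big_split /=; apply: eq_bigr => i _.
  rewrite (bigID (fun j : 'I_n => (i < j)%N)) /=; congr (_ + _).
  rewrite (bigD1 i) ?ltnn //= G0 add0r; apply: eq_bigl => j.
  by rewrite -val_eqE /=; case: ltngtP.
rewrite [X in _ + X](exchange_big_dep xpredT) //= -big_split /= big1 // => i _.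
by rewrite -big_split /= big1 // => j ij; rewrite (GN i j) // subrr.
Qed.

(** [J] plays the role of an ideal, and this is the fact that its radical is one: in the binomial
    expansion of [(s + t) ^+ (N + L)] every term contains [s ^+ N] or [t ^+ L]. *)
Lemma radical_lincomb (T : comPzRingType) (n : nat) (x a : 'I_n -> T)
    (U : {set 'I_n}) (J : T -> Prop) :
  J 0 -> (forall s t, J s -> J t -> J (s + t)) ->
  (forall s t, J t -> J (s * t)) ->
  (forall i, i \in U -> exists N, J (x i ^+ N)) ->
  exists N, J ((\sum_(i in U) a i * x i) ^+ N).
Proof.
move=> J0 JD JM JU.
apply: (big_ind (fun t => exists N, J (t ^+ N))) => [|s t [N sN] [L tL]|i iU].
- by exists 1%N; rewrite expr1.
- exists (N + L)%N; rewrite exprDn.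
  apply: (big_ind J) => // i _; rewrite -mulr_natl; apply: (JM).
  have [iL|Li] := leqP L i.
    by rewrite -(subnK iL) exprD mulrA; apply: (JM).
  have -> : (N + L - i = (L - i) + N)%N by lia.
  by rewrite exprD mulrAC; apply: (JM).
by have [N xN] := JU i iU; exists N; rewrite exprMn; apply: JM.
Qed.

(** * Maps between localizations *)

Section LocMap.
Variables (T : comPzRingType) (M : lmodType T) (t h u : T).
Hypothesis uE : u = h * t.

Let L := HB.pack_for {linear loc M t -> loc M u} (loc_map (M := M) h u)
  (GRing.isLinear.Build _ _ _ _ _ (loc_map_linear (M := M) uE)).

Lemma loc_map0 : loc_map h u (0 : loc M t) = 0.
Proof. exact: (linear0 L). Qed.

Lemma loc_mapB (z w : loc M t) : loc_map h u (z - w) = loc_map h u z - loc_map h u w.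
Proof. exact: (linearB L). Qed.

Lemma loc_mapZ a (z : loc M t) : loc_map h u (a *: z) = a *: loc_map h u z.
Proof. exact: (linearZ_LR L). Qed.

Lemma loc_map_sum (I : Type) (s : seq I) (P : pred I) (F : I -> loc M t) :
  loc_map h u (\sum_(i <- s | P i) F i) = \sum_(i <- s | P i) loc_map h u (F i).
Proof. exact: (linear_sum L). Qed.

Lemma frac0 k : frac t (0 : M) k = 0.
Proof. by apply/frac_eqP; exists 0%N; rewrite !scaler0. Qed.

Lemma frac_eq0 (m : M) k : frac t m k = 0 <-> exists N, t ^+ N *: m = 0.
Proof.
rewrite -(frac0 0); split=> [/frac_eqP[N e]|[N e]].
  by exists N; move: e; rewrite expr0 scale1r !scaler0.
by apply/frac_eqP; exists N; rewrite expr0 scale1r e !scaler0.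
Qed.

(** The target is the localization of [loc M t] at [h]. Hence kernel and cokernel are [h]-power
    torsion, and [h] acts bijectively on the target; this and the next three lemmas record it. *)
Lemma loc_map_ker (z : loc M t) :
  loc_map h u z = 0 -> exists N, h ^+ N *: z = 0.
Proof.
elim/loc_ind: z => m k; rewrite (loc_mapE uE) => /(@frac_eqP _ _ u _ _ 0 0)[N].
rewrite expr0 scale1r !scaler0 scalerA => e.
exists (N + k)%N; rewrite fracZ; apply/frac_eq0; exists N.
by rewrite scalerA -e uE exprMn exprD; congr (_ *: _); rewrite mulrC mulrAC.
Qed.

Lemma loc_map_coker (z : loc M u) :
  exists N (w : loc M t), loc_map h u w = h ^+ N *: z.
Proof.
elim/loc_ind: z => m k; exists k, (frac t m k).
by rewrite (loc_mapE uE) fracZ.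
Qed.

Lemma loc_scale_inj L' (z : loc M u) : h ^+ L' *: z = 0 -> z = 0.
Proof.
elim/loc_ind: z => m k.
rewrite fracZ => /(@frac_eqP _ _ u _ _ 0 0)[N].
rewrite expr0 scale1r !scaler0 scalerA => e.
apply/(@frac_eqP _ _ u _ _ 0 0); exists (N + L')%N; rewrite expr0 scale1r !scaler0.
by rewrite exprD {2}uE exprMn mulrA mulrC -scalerA e scaler0.
Qed.

Lemma loc_scale_surj L' (z : loc M u) : exists w, h ^+ L' *: w = z.
Proof.
elim/loc_ind: z => m k; exists (frac u (t ^+ L' *: m) (k + L')).
rewrite fracZ; apply/frac_eqP; exists 0%N.
by rewrite !expr0 !scale1r !scalerA -mulrA -exprMn -uE exprD.
Qed.

End LocMap.

(** * Calculus of conditions satisfied by elements of arbitrarily small value *)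

Section Almost.
Variables (K : realType) (T : comPzRingType) (v : T -> \bar K).
Hypothesis vv : value_map v.

Definition almost (P : T -> Prop) : Prop :=
  forall eps : K, 0 < eps -> exists b, P b /\ (v b < eps%:E)%E.

(** Values add along products, so each of the two factors is allowed half of [eps]. *)
Lemma almost_bind (P Q : T -> Prop) :
  almost P -> (forall b, P b -> almost (fun b' => Q (b' * b))) -> almost Q.
Proof.
move=> aP aQ eps eps0.
have eps2 : 0 < eps / 2 by rewrite divr_gt0.
have [b [Pb vb]] := aP _ eps2.
have [b' [Qb vb']] := aQ b Pb _ eps2.
exists (b' * b); split=> //.
have [_ vM _ _] := vv.
by rewrite vM (splitr eps) EFinD lteD.
Qed.

Lemma almost_mono (P Q : T -> Prop) :
  (forall b, P b -> Q b) -> almost P -> almost Q.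
Proof. by move=> PQ aP eps /aP[b [/PQ Qb vb]]; exists b. Qed.

(* If T = 0, then v is constantly +oo and nothing is almost true. *)
Lemma almost_triv (P Q : T -> Prop) : almost P -> Q 1 -> almost Q.
Proof.
move=> aP Q1; have [b [_ vb]] := aP 1 ltr01.
have [vN vM _ _] := vv.
suff v1 : v 1 = 0%E by move=> eps eps0; exists 1; rewrite v1 lte_fin.
have := vM 1 1; have := vM 1 b; rewrite !mul1r.
move: vb (vN b) (vN 1); case: (v b) => // y _ _.
case: (v 1) => // z _ /eqP; rewrite eqe -[X in X == _]add0r => /eqP/addIr <-.
by [].
Qed.

(** A product of witnesses, one per index, serves all indices because each [P i] is stable under
    multiples. For no index the witness is 1, whose value is 0 thanks to [almost (fun=> True)]. *)
Lemma almost_all (I : finType) (Q : pred I) (P : I -> T -> Prop) :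
  almost (fun=> True) -> (forall i b b', P i b -> P i (b' * b)) ->
  (forall i, Q i -> almost (P i)) -> almost (fun b => forall i, Q i -> P i b).
Proof.
move=> aT PM aP.
have : almost (fun b => forall i, i \in enum I -> Q i -> P i b).
  elim: (enum I) => [|i s IH]; first exact: almost_triv aT _.
  apply: almost_bind IH _ => b Pb.
  have [Qi|nQi] := boolP (Q i); last first.
    apply: (almost_triv aT) => j; rewrite inE mul1r => /orP[/eqP->|].
      by rewrite (negPf nQi).
    exact: Pb.
  apply: almost_mono (aP i Qi) => b' Pb' j; rewrite inE => /orP[/eqP-> _|js Qj].
    by rewrite mulrC; apply: PM.
  by apply: PM; apply: Pb.
by apply: almost_mono => b H i; apply: H; rewrite mem_enum.
Qed.

End Almost.

(** * Torsion of Cech cohomology *)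

Section CechComplex.
Variables (T : comPzRingType) (n : nat) (x : 'I_n -> T) (M : lmodType T).
Implicit Types (c e g : cech x M) (A B S U V : {set 'I_n}) (i j h : 'I_n)
  (u w : {set 'I_n} -> cech x M).

Lemma cechD c e S : (c + e) S = c S + e S. Proof. by []. Qed.
Lemma cechN c S : (- c) S = - c S. Proof. by []. Qed.
Lemma cechZ a c S : (a *: c) S = a *: c S. Proof. by []. Qed.

Lemma cech_sumE (I : Type) (s : seq I) (P : pred I) (F : I -> cech x M) S :
  (\sum_(k <- s | P k) F k) S = \sum_(k <- s | P k) F k S.
Proof. by apply: (big_morph (fun c => c S)). Qed.

Lemma cechP c e : (forall S, c S = e S) -> c = e.
Proof. exact: functional_extensionality_dep. Qed.

Lemma cech_d_eq0 c S :
  (forall i, i \in S -> c (S :\ i) = 0) -> cech_d c S = 0.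
Proof.
move=> cS; rewrite /cech_d big1 // => i iS.
by rewrite cS // (loc_map0 _ (cech_prodD1 x iS)) scaler0.
Qed.

Lemma cech_d_D1 c S i : i \in S -> (forall j, j \in S -> j != i -> c (S :\ j) = 0) ->
  cech_d c S = cech_sign T i S *: loc_map (x i) (cech_prod x S) (c (S :\ i)).
Proof.
move=> iS cS; rewrite /cech_d (bigD1 i) //= big1 ?addr0 // => j /andP[jS ji].
by rewrite cS // (loc_map0 _ (cech_prodD1 x jS)) scaler0.
Qed.

Lemma cech_sign_sq i S : cech_sign T i S * cech_sign T i S = 1.
Proof. by rewrite -expr2 sqrr_sign. Qed.

Lemma cech_prodU1 i S : i \notin S -> cech_prod x (i |: S) = x i * cech_prod x S.
Proof. by move=> iS; rewrite (cech_prodD1 x (setU11 i S)) setU1K. Qed.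

(** After multiplication by a power of [x i], the components of [c] at sets containing [i] lift to
    localizations where [x i] is not inverted. Subtracting the boundary of the lifts leaves a
    cocycle on [V] supported off [i]; its boundary at [i |: S] is a single localized component, so a
    further power of [x i] kills that component. The vanishing clause lets [e] inherit degree and
    support from [c]. *)
Lemma cech_torsion V c i : i \in V ->
  (forall S, S \subset V -> cech_d c S = 0) ->
  exists N e, (forall S, i \in S \/ c (i |: S) = 0 -> e S = 0) /\
    (forall S, S \subset V -> x i ^+ N *: c S = cech_d e S).
Proof.
move=> iV dc.
have lift_c S : exists p : nat * loc M (cech_prod x S),
    (i \notin S -> loc_map (x i) (cech_prod x (i |: S)) p.2 =
       x i ^+ p.1 *: c (i |: S)) /\
    (i \in S \/ c (i |: S) = 0 -> p.2 = 0).
  have [iS|iS] := boolP (i \in S); first by exists (0%N, 0).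
  (* A zero component must get the lift 0, not just some torsion element, for the vanishing
     clause. *)
  have [c0|c0] := pselect (c (i |: S) = 0).
    exists (0%N, 0); split=> //= _.
    by rewrite (loc_map0 _ (cech_prodU1 iS)) c0 scaler0.
  have [N [w e]] := loc_map_coker (cech_prodU1 iS) (c (i |: S)).
  by exists (N, w); split=> //= -[].
have [p pP] := fin_all_exists lift_c.
pose N := \max_S (p S).1.
(* The powers bring all exponents to the common [N]; the sign cancels the one in [cech_d]. *)
pose e : cech x M := fun S =>
  cech_sign T i (i |: S) *: (x i ^+ (N - (p S).1) *: (p S).2).
have e0 S : i \in S \/ c (i |: S) = 0 -> e S = 0.
  by move=> /(proj2 (pP S)) p0; rewrite /e p0 !scaler0.
have eE S : i \in S -> cech_sign T i S *: loc_map (x i) (cech_prod x S) (e (S :\ i)) =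
    x i ^+ N *: c S.
  move=> iS; have iS' : i \notin S :\ i by rewrite setD11.
  rewrite /e !(loc_mapZ (cech_prodD1 x iS)).
  have := proj1 (pP (S :\ i)) iS'; rewrite setD1K // => ->.
  rewrite !scalerA mulrA cech_sign_sq mul1r -exprD subnK //.
  exact: (leq_bigmax (F := fun S => (p S).1)).
pose g := x i ^+ N *: c - cech_d e.
have g0 S : i \in S -> g S = 0.
  move=> iS; rewrite /g cechD cechN cechZ (cech_d_D1 iS) ?eE ?subrr // => j jS ji.
  by apply: e0; left; rewrite !inE eq_sym ji.
have dg S : S \subset V -> cech_d g S = 0.
  by move=> SV; rewrite /g linearB linearZ /= cech_dd subr0 cechZ dc ?scaler0.
have kill_g S : exists L, S \subset V -> x i ^+ L *: g S = 0.
  have [iS|iS] := boolP (i \in S); first by exists 0%N; rewrite g0 ?scaler0.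
  have [SV|] := boolP (S \subset V); last by exists 0%N.
  have iW := setU11 i S.
  suff /(loc_map_ker (cech_prodU1 iS)) [L gL] :
    loc_map (x i) (cech_prod x (i |: S)) (g S) = 0 by exists L.
  have := dg (i |: S); rewrite subUset sub1set iV SV => /(_ isT).
  rewrite (cech_d_D1 iW) => [|j jS ji]; last by rewrite g0 // !inE eq_sym ji eqxx.
  rewrite setU1K // => /(congr1 (fun z => cech_sign T i (i |: S) *: z)).
  by rewrite scalerA cech_sign_sq scale1r scaler0.
have [l lP] := fin_all_exists kill_g.
pose L := \max_S l S.
exists (L + N)%N, (x i ^+ L *: e); split=> S.
  by move=> /e0 eS; rewrite cechZ eS scaler0.
move=> SV; have lL : (l S <= L)%N by exact: leq_bigmax.
apply/eqP; rewrite -subr_eq0 linearZ /= cechZ exprD -scalerA -scalerBr.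
by rewrite -[_ - _]/(g S) -(subnK lL) exprD -scalerA lP ?scaler0.
Qed.

(** The multipliers that turn [c] into a coboundary on [V], with these vanishing clauses, form an
    ideal. It contains a power of each [x i] with [i] in [U], so [radical_lincomb] applies. *)
Lemma cech_torsion_lincomb V (a : 'I_n -> T) U c :
  U \subset V -> (forall S, S \subset V -> cech_d c S = 0) ->
  exists N e,
    [/\ forall S, (forall i, i \in U -> c (i |: S) = 0) -> e S = 0,
        forall p, cech_deg p c -> forall S, #|S|.+1 <> p -> e S = 0
      & forall S, S \subset V ->
          (\sum_(i in U) a i * x i) ^+ N *: c S = cech_d e S].
Proof.
move=> UV dc.
apply: (@radical_lincomb T n x a U (fun t => exists e,
    [/\ forall S, (forall i, i \in U -> c (i |: S) = 0) -> e S = 0,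
        forall p, cech_deg p c -> forall S, #|S|.+1 <> p -> e S = 0
      & forall S, S \subset V -> t *: c S = cech_d e S])).
- by exists 0; split=> // S _; rewrite scale0r linear0.
- move=> s t [e [es ed eE]] [e' [es' ed' eE']]; exists (e + e'); split.
  + by move=> S cS; rewrite cechD es ?es' ?addr0.
  + by move=> p cp S Sp; rewrite cechD (ed p) ?(ed' p) ?addr0.
  + by move=> S SV; rewrite scalerDl eE // eE' // linearD.
- move=> s t [e [es ed eE]]; exists (s *: e); split.
  + by move=> S cS; rewrite cechZ es ?scaler0.
  + by move=> p cp S Sp; rewrite cechZ (ed p) ?scaler0.
  + by move=> S SV; rewrite linearZ /= cechZ -eE // scalerA.
move=> i iU; have [N [e [e0 eE]]] := cech_torsion (subsetP UV i iU) dc.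
exists N, e; split=> // [S cS|p cp S Sp]; apply: e0; first by right; apply: cS.
have [iS|iS] := boolP (i \in S); [by left | right].
by apply: cp; rewrite cardsU1 iS.
Qed.

(** [x h] is invertible on the components at sets containing [h]: surjectivity gives the quotient,
    injectivity makes it vanish where [e] does. *)
Lemma cech_divide h L e : exists e', forall S,
  (h \in S -> x h ^+ L *: e' S = e S) /\ (h \notin S \/ e S = 0 -> e' S = 0).
Proof.
apply: (fin_all_exists (P := fun S (z : loc M (cech_prod x S)) =>
  (h \in S -> x h ^+ L *: z = e S) /\ (h \notin S \/ e S = 0 -> z = 0))) => S.
have [hS|hS] := boolP (h \in S); last by exists 0.
have hE := cech_prodD1 x hS; have [z zE] := loc_scale_surj hE L (e S).
exists z; split=> // -[//|eS].
by apply: (loc_scale_inj (L' := L) hE); rewrite zE.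
Qed.

(** * Almost acyclicity and enlargement of the sequence *)

Section AlmostAcyclic.
Variables (K : realType) (v : T -> \bar K).
Hypothesis vv : value_map v.

(* Almost vanishing of the p-th cohomology of the Cech complex on the x_i with
   i in U, seen as the quotient of [cech x M] formed by the components indexed
   by the subsets of U. *)
Definition almost_acyclic U (p : nat) : Prop :=
  forall c, cech_deg p c -> (forall S, S \subset U -> cech_d c S = 0) ->
    almost v (fun b => exists e, (forall S, #|S|.+1 <> p -> e S = 0) /\
      forall S, S \subset U -> b *: c S = cech_d e S).

(* A cocycle for h |: U is almost cohomologous to one supported on the sets
   containing h.  The latter is killed up to coboundary by a power of x_h, which
   is a combination of powers of the x_i, and x_h is invertible on its support. *)
Lemma almost_acyclicU1 U p h (a : 'I_n -> T) : h \notin U ->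
  x h = \sum_(i in U) a i * x i -> almost_acyclic U p ->
  almost_acyclic (h |: U) p.
Proof.
move=> hU xh acU c cp dc.
have := acU c cp (fun S SU => dc S (subset_trans SU (subsetUr _ _))).
apply: almost_mono => b [e [ep ce]].
pose g := b *: c - cech_d e.
have gp : cech_deg p g.
  move=> S Sp; rewrite /g cechD cechN cechZ cp // scaler0 sub0r.
  rewrite cech_d_eq0 ?oppr0 // => i iS.
  by apply: ep; rewrite (cardsD1 i S) iS in Sp.
have dg S : S \subset h |: U -> cech_d g S = 0.
  by move=> SV; rewrite /g linearB linearZ /= cech_dd subr0 cechZ dc ?scaler0.
have subU S : S \subset h |: U -> h \notin S -> S \subset U.
  move=> /subsetP SV hS; apply/subsetP => i iS.
  by have := SV i iS; rewrite !inE => /orP[/eqP ih|//]; rewrite -ih iS in hS.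
have g0 S : S \subset h |: U -> h \notin S -> g S = 0.
  move=> SV hS; rewrite /g cechD cechN cechZ ce ?subrr //; exact: subU.
have [L [f [f0 fp fE]]] := cech_torsion_lincomb a (subsetUr [set h] U) dg.
have [f' f'P] := cech_divide h L f.
have ff' S : S \subset h |: U -> f S = x h ^+ L *: f' S.
  move=> SV; have [hS|hS] := boolP (h \in S); first by rewrite (f'P S).1.
  rewrite (f'P S).2 ?scaler0; last by left.
  (* For [i] in [U], the set [i |: S] still misses [h], so [g] vanishes there. *)
  apply: f0 => i iU; apply: g0.
    by rewrite subUset sub1set !inE iU orbT.
  by rewrite !inE negb_or hS andbT; apply: contraNneq hU => ->.
exists (e + f'); split=> [S Sp|S SV].
  by rewrite cechD ep // (f'P S).2 ?addr0 //; right; apply: fp Sp.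
rewrite linearD /= cechD; apply/eqP; rewrite addrC -subr_eq; apply/eqP.
rewrite -[LHS]/(g S); have [hS|hS] := boolP (h \in S); last first.
  rewrite g0 // cech_d_eq0 // => i iS; apply: (f'P _).2; left.
  by rewrite inE (negPf hS) andbF.
apply/eqP; rewrite -subr_eq0; apply/eqP.
(* As [x h] acts injectively here, the identity may be checked after multiplying by [x h ^+ L],
   which turns [f'] into [f]. *)
apply: (loc_scale_inj (L' := L) (cech_prodD1 x hS)); apply/eqP.
rewrite scalerBr subr_eq0 {1}xh fE // -cechZ -linearZ /=; apply/eqP.
apply: eq_bigr => i iS; congr (_ *: loc_map _ _ _).
by apply: ff'; apply: subset_trans SV; apply: subsetDl.
Qed.

(** The missing indices are added one at a time, by induction on the size of the complement of
    [U]. *)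
Lemma almost_acyclicT U p :
  (forall h, exists a : 'I_n -> T, x h = \sum_(i in U) a i * x i) ->
  almost_acyclic U p -> almost_acyclic [set: 'I_n] p.
Proof.
have [k] := ubnP #|~: U|; elim: k U => // k IH U ltk gen acU.
have [UT|] := eqVneq U [set: 'I_n]; first by rewrite -UT.
rewrite -subTset => /subsetPn[h _ hU].
apply: (IH (h |: U)) => [|i|].
- rewrite -ltnS; apply: leq_trans ltk; rewrite ltnS; apply: proper_card.
  rewrite setCU; apply/properP; split; first exact: subsetIr.
  by exists h; rewrite !inE ?eqxx.
- have [a aE] := gen i; exists (fun j => if j \in U then a j else 0).
  rewrite big_setU1 //= (negPf hU) mul0r add0r aE.
  by apply: eq_bigr => j ->.
- by have [a aE] := gen h; apply: almost_acyclicU1 aE acU.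
Qed.

(** The differential is homogeneous, so the finitely many homogeneous parts of a cocycle are treated
    separately. The double complex argument can then ignore the Cech degree. *)
Lemma almost_exact : (forall p, almost_acyclic [set: 'I_n] p) ->
  forall c, cech_d c = 0 -> almost v (fun b => exists e, b *: c = cech_d e).
Proof.
move=> ac c dc.
pose cp p : cech x M := fun S => if #|S| == p then c S else 0.
have cE : c = \sum_(p < n.+1) cp p.
  apply: cechP => S; rewrite cech_sumE.
  have Sn : (#|S| < n.+1)%N by rewrite ltnS -[n in (_ <= n)%N]card_ord max_card.
  rewrite (bigD1 (Ordinal Sn)) //= big1 ?addr0; first by rewrite /cp eqxx.
  by move=> p; rewrite /cp -val_eqE /= eq_sym => /negPf->.
have acp p : almost v (fun b => exists e, b *: cp p = cech_d e).
  have deg_cp : cech_deg p (cp p) by move=> S /eqP/negPf Sp; rewrite /cp Sp.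
  have dcp S : S \subset [set: 'I_n] -> cech_d (cp p) S = 0.
    move=> _; have [Sp|Sp] := eqVneq #|S| p.+1; last first.
      apply: cech_d_eq0 => i iS; apply: deg_cp => ip.
      by rewrite (cardsD1 i S) iS ip eqxx in Sp.
    rewrite -[RHS](congr1 (fun z : cech x M => z S) dc).
    apply: eq_bigr => i iS; rewrite /cp.
    by move/eqP: Sp; rewrite (cardsD1 i S) iS eqSS => ->.
  apply: almost_mono (ac p _ deg_cp dcp) => b [e [_ eE]]; exists e.
  by apply: cechP => S; rewrite cechZ eE.
have trivT : almost v (fun=> True) by apply: almost_mono (acp 0%N).
have PM (p : 'I_n.+1) b b' : (exists e, b *: cp p = cech_d e) ->
    exists e, (b' * b) *: cp p = cech_d e.
  by move=> [e eE]; exists (b' *: e); rewrite linearZ /= -eE scalerA.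
apply: almost_mono (almost_all vv trivT PM (fun p _ => acp p)).
move=> b be; have [e eE] := fin_all_exists (fun p => be p isT).
exists (\sum_p e p).
by rewrite linear_sum {1}cE scaler_sumr; apply: eq_bigr => p _.
Qed.

End AlmostAcyclic.

(** * The Koszul complex on [x] with coefficients in the Cech complex *)

Definition koszul_d u A : cech x M :=
  \sum_(i | i \notin A) (cech_sign T i (i |: A) * x i) *: u (i |: A).

Lemma koszul_dd u A : koszul_d (koszul_d u) A = 0.
Proof.
(* Extending the summands by zero to all pairs makes [G] antisymmetric. *)
pose G i j := if [&& i \notin A, j \notin A & i != j] then
  (cech_sign T i (i |: A) * x i * (cech_sign T j (j |: (i |: A)) * x j)) *:
    u (j |: (i |: A)) else 0.
transitivity (\sum_i \sum_j G i j).
  rewrite /koszul_d big_mkcond /=; apply: eq_bigr => i _; case: ifP => iA.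
    rewrite scaler_sumr big_mkcond /=; apply: eq_bigr => j _.
    by rewrite /G iA !inE negb_or andbC eq_sym scalerA.
  by rewrite big1 // => j _; rewrite /G iA.
apply: sum_antisym => [i|i j ij]; rewrite /G ?eqxx ?andbF //.
rewrite [j == i]eq_sym; case: (boolP (i \in A)) => iA; rewrite ?andbF ?oppr0 //=.
case: (boolP (j \in A)) => jA; rewrite ?oppr0 //=.
have nij : i != j by rewrite -val_eqE /= ltn_eqF.
rewrite nij -scaleNr [i |: (j |: A)]setUCA; congr (_ *: _).
have := cech_sign_swap T (S := j |: (i |: A)) (i := i) (j := j).
rewrite !inE !eqxx orbT => /(_ isT isT ij).
rewrite setU1K ?inE ?negb_or 1?eq_sym ?nij //.
have -> : (j |: (i |: A)) :\ i = j |: A.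
  by rewrite setUCA setU1K // !inE negb_or nij.
move=> E; rewrite mulrACA [in RHS]mulrACA [x j * x i]mulrC -mulNr.
by congr (_ * _); rewrite mulrC [in RHS]mulrC E opprK.
Qed.

Lemma koszul_dZ b u A : koszul_d (fun B => b *: u B) A = b *: koszul_d u A.
Proof.
by rewrite /koszul_d scaler_sumr; apply: eq_bigr => i _; rewrite !scalerA mulrC.
Qed.

Lemma koszul_cech_d u A :
  cech_d (koszul_d u A) = koszul_d (fun B => cech_d (u B)) A.
Proof. by rewrite /koszul_d linear_sum; apply: eq_bigr => i _; rewrite linearZ. Qed.

Lemma eq_koszul_d u w A : (forall B, #|B| = #|A|.+1 -> u B = w B) ->
  koszul_d u A = koszul_d w A.
Proof.
by move=> uw; apply: eq_bigr => i iA; rewrite uw // cardsU1 iA.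
Qed.

Definition diag_cech (m : M) A : cech x M :=
  fun S => if S == A then frac (cech_prod x S) m 1 else 0.

(** Both sides live on the sets [i |: A] with [i] outside [A]. There the Cech side maps the fraction
    at [A] into the finer localization and the Koszul side multiplies the fraction at [i |: A] by
    [x i], with the same sign. *)
Lemma diag_cech_d m A : cech_d (diag_cech m A) = koszul_d (diag_cech m) A.
Proof.
apply: cechP => S; rewrite /koszul_d cech_sumE /cech_d.
rewrite big_mkcond [RHS]big_mkcond /=; apply: eq_bigr => i _.
rewrite cechZ /diag_cech; have [SA|SA] := boolP ((i \notin A) && (S == i |: A)).
  have /andP[iA /eqP->] := SA.
  rewrite setU11 iA setU1K // !eqxx (loc_mapE (cech_prodU1 iA)) expr1.
  by rewrite -scalerA fracZ.
have -> : (if i \notin A then (cech_sign T i (i |: A) * x i) *: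
    (if S == i |: A then frac (cech_prod x S) m 1 else 0) else 0) = 0.
  by case: ifP => // iA; rewrite iA /= in SA; rewrite (negPf SA) scaler0.
case: ifP => // iS; rewrite ifN ?(loc_map0 _ (cech_prodD1 x iS)) ?scaler0 //.
by apply: contraNneq SA => <-; rewrite setD1K // eqxx setD11.
Qed.

Lemma frac_add_den0 (t : T) (z w : M) : frac t (z + w) 0 = frac t z 0 + frac t w 0.
Proof. by rewrite fracD expr0 !scale1r. Qed.

Lemma frac_den1 (z : loc M (1 : T)) : exists w : M, z = frac 1 w 0.
Proof.
elim/loc_ind: z => w k; exists w.
by apply/frac_eqP; exists 0%N; rewrite !expr1n.
Qed.

Lemma frac_inj1 k l (z w : M) : frac (1 : T) z k = frac 1 w l -> z = w.
Proof. by move=> /frac_eqP[N]; rewrite !expr1n !scale1r. Qed.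

(* Descending double complex argument on the tensor product of the Cech and the
   Koszul complexes: the family [diag_cech m] is a cycle of the total complex,
   and each row being almost exact, almost a boundary. *)
Lemma almost_lincomb (K : realType) (v : T -> \bar K) : value_map v ->
  (forall c, cech_d c = 0 -> almost v (fun b => exists e, b *: c = cech_d e)) ->
  forall m : M, almost v (fun b => exists z : 'I_n -> M, b *: m = \sum_i x i *: z i).
Proof.
move=> vv exact_x m.
have trivT : almost v (fun=> True) by apply: almost_mono (exact_x 0 (linear0 _)).
(* The range of [A] is empty for [k = 0] and contains all sets for [k = n.+1]. *)
have descent k : almost v (fun b => exists u, forall A, (n < #|A| + k)%N ->
    b *: diag_cech m A = cech_d (u A) + koszul_d u A).
  elim: k => [|k IH].
    apply: (almost_triv vv trivT); exists (fun=> 0) => A.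
    by rewrite addn0 ltnNge -[n in (_ <= n)%N]card_ord max_card.
  apply: (almost_bind vv IH) => b [u uE].
  pose w A := b *: diag_cech m A - koszul_d u A.
  (* By the equation already known at the sets [i |: A], this boundary equals
     [koszul_d (koszul_d u) A]. *)
  have dw A : (#|A| + k == n)%N -> cech_d (w A) = 0.
    move=> /eqP Ak; rewrite /w linearB linearZ /= diag_cech_d koszul_cech_d -koszul_dZ.
    apply/eqP; rewrite subr_eq0; apply/eqP/esym.
    rewrite -[LHS]addr0 -(koszul_dd u A) /koszul_d -big_split /=.
    apply: eq_bigr => i iA; rewrite -scalerDr uE // cardsU1 iA.
    by rewrite add1n addSn Ak.
  have PM A b' b'' : (exists e, b' *: w A = cech_d e) ->
      exists e, (b'' * b') *: w A = cech_d e.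
    by move=> [e eE]; exists (b'' *: e); rewrite linearZ /= -eE scalerA.
  apply: almost_mono (almost_all vv trivT PM (fun A Ak => exact_x _ (dw A Ak))).
  move=> b' b'E.
  have /fin_all_exists[e eE] A : exists e, (#|A| + k == n)%N -> b' *: w A = cech_d e.
    by case: eqP => [/eqP/b'E[e eE]|_]; [exists e | exists 0].
  (* The new primitives enter at the size just reached; elsewhere [u] is rescaled by the new
     factor. *)
  exists (fun A => if (#|A| + k == n)%N then e A else b' *: u A) => A nA.
  have -> : koszul_d (fun B => if (#|B| + k == n)%N then e B else b' *: u B) A =
      b' *: koszul_d u A.
    rewrite -koszul_dZ; apply: eq_koszul_d => B BA; rewrite ifF //.
    by apply/eqP; lia.
  case: ifP => [Ak|/eqP Ak].
    by rewrite -eE // /w scalerBr scalerA subrK.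
  by rewrite -scalerA uE ?scalerDr ?linearZ //; lia.
apply: almost_mono (descent n.+1) => b [u /(_ set0)].
rewrite cards0 add0n ltnS leqnn => /(_ isT)/(congr1 (fun c => c set0)).
(* At [A = S = set0] the Cech boundary is an empty sum, and the localization at the empty product 1
   is [M]. *)
rewrite cechD cechZ (cech_d_eq0 (c := u set0)) ?add0r; last first.
  by move=> i; rewrite inE.
rewrite /diag_cech /koszul_d eqxx cech_sumE fracZ.
have E1 : cech_prod x set0 = 1 by rewrite /cech_prod big_set0.
have [y yE] : exists y : 'I_n -> M, forall i,
    ((cech_sign T i (i |: set0) * x i) *: u (i |: set0)) set0 =
    frac (cech_prod x set0) (x i *: y i) 0.
  apply: (fin_all_exists (P := fun i (y : M) => _ = frac _ (x i *: y) 0)) => i.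
  rewrite cechZ; move: (u _ _); rewrite E1 => z.
  have [w ->] := frac_den1 z; exists (cech_sign T i (i |: set0) *: w).
  by rewrite fracZ !scalerA mulrC.
rewrite (eq_bigr _ (fun i _ => yE i)) E1.
rewrite -(big_morph (fun z : M => frac 1 z 0) (@frac_add_den0 1) (erefl _)).
move=> /frac_inj1->; exists y.
by apply: eq_bigl => i; rewrite inE.
Qed.

End CechComplex.

(** * Almost vanishing of quotients in terms of representatives *)

Lemma quotmod_scale_eq0 (T : pzRingType) (V : lmodType T) (S : submodClosed V)
    (a : T) (y : V) :
  a *: (\pi_(quotmod S) y : quotmod S) = 0 <-> a *: y \in S.
Proof.
have -> : a *: (\pi_(quotmod S) y : quotmod S) = \pi_(quotmod S) (a *: y).
  exact: quotmod_pi_scale.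
have -> : (0 : quotmod S) = \pi_(quotmod S) 0 by rewrite raddf0.
by rewrite -[a *: y in X in _ <-> X]subr0 -quotmod_eqE; split=> /eqP.
Qed.

Lemma almost_zero_cohomology (K : realType) (T : comPzRingType) (v : T -> \bar K)
    (n : nat) (x : 'I_n -> T) (M : lmodType T) (p : nat) :
  almost_zero v (cech_cohomology x M p) ->
  forall c : cech x M, cech_deg p c -> cech_d c = 0 ->
    almost v (fun b => exists e : cech x M,
      (forall S : {set 'I_n}, #|S|.+1 <> p -> e S = 0) /\ b *: c = cech_d e).
Proof.
move=> az c cp dc eps eps0.
have cz : c \in cocycle (x := x) (M := M) p by apply/asboolP.
have [b [+ vb]] := az (\pi_(quotmod (@coboundary _ _ x M p)) (Cocycles cz)) _ eps0.
by move=> /quotmod_scale_eq0/asboolP bE; exists b.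
Qed.

(** * The Cech complex of an increasing subfamily *)

Section Subfamily.
Variables (T : comPzRingType) (q n : nat) (phi : 'I_q -> 'I_n).
Hypothesis phi_lt : forall i j : 'I_q, (phi i < phi j)%N = (i < j)%N.
Variables (x : 'I_n -> T) (x' : 'I_q -> T) (M : lmodType T).
Hypothesis x'E : forall i, x' i = x (phi i).

Lemma phi_inj : injective phi.
Proof.
move=> i j e; apply: val_inj => /=.
by case: (ltngtP i j) (phi_lt i j) (phi_lt j i); rewrite e ltnn.
Qed.

(** The two products are equal but index different localization types; the factor 1 gives the
    equation the shape required by [loc_map] between them. *)
Lemma cech_prod_sub (S : {set 'I_q}) : cech_prod x' S = 1 * cech_prod x (phi @: S).
Proof.
rewrite mul1r /cech_prod big_imset /=; last by move=> i j _ _ /phi_inj.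
by apply: eq_bigr => i _.
Qed.

Lemma cech_sign_sub (S : {set 'I_q}) i :
  cech_sign T (phi i) (phi @: S) = cech_sign T i S.
Proof.
rewrite /cech_sign -(card_imset [set j in S | (j < i)%N] phi_inj).
congr (_ ^+ #|pred_of_set _|); apply/setP => k; rewrite inE.
apply/andP/imsetP => [[/imsetP[j jS ->]]|[j]]; rewrite ?phi_lt.
  by move=> ji; exists j; rewrite ?inE ?jS.
by rewrite inE => /andP[jS ji] ->; rewrite phi_lt imset_f.
Qed.

Definition cech_restr (c : cech x M) : cech x' M :=
  fun S => loc_map 1 (cech_prod x' S) (c (phi @: S)).

Lemma cech_restr_d c S :
  cech_d (cech_restr c) S = loc_map 1 (cech_prod x' S) (cech_d c (phi @: S)).
Proof.
have pS := cech_prod_sub S.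
rewrite /cech_d (loc_map_sum pS) big_imset /=; last by move=> i j _ _ /phi_inj.
apply: eq_bigr => i iS; rewrite (loc_mapZ pS) cech_sign_sub; congr (_ *: _).
have phiS : phi i \in phi @: S by rewrite imset_f.
rewrite (loc_map_comp (cech_prodD1 x phiS) pS) /cech_restr.
rewrite (loc_map_comp (cech_prod_sub _) (cech_prodD1 x' iS)).
have -> : phi @: (S :\ i) = phi @: S :\ phi i.
  apply/setP => k; rewrite !inE; apply/imsetP/andP => [[j]|[ki /imsetP[j jS kE]]].
    by rewrite !inE => /andP[ji jS] ->; rewrite (inj_eq phi_inj) ji imset_f.
  by exists j; rewrite // !inE jS andbT -(inj_eq phi_inj) -kE.
by rewrite x'E mulr1 mul1r.
Qed.

(** Powers of 1 act trivially, so [loc_map 1] is bijective and every component lifts uniquely;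
    components at sets that are not images are taken to be 0. *)
Lemma cech_extend (e' : cech x' M) : exists e : cech x M, cech_restr e = e' /\
  forall S, (forall S' : {set 'I_q}, phi @: S' = S -> e' S' = 0) -> e S = 0.
Proof.
have [e eE] : exists e : cech x M, forall S,
    (forall S' : {set 'I_q}, phi @: S' = S -> loc_map 1 (cech_prod x' S') (e S) = e' S') /\
    ((forall S' : {set 'I_q}, phi @: S' = S -> e' S' = 0) -> e S = 0).
  apply: (fin_all_exists (P := fun S (z : loc M (cech_prod x S)) =>
    (forall S' : {set 'I_q}, phi @: S' = S -> loc_map 1 (cech_prod x' S') z = e' S') /\
    ((forall S' : {set 'I_q}, phi @: S' = S -> e' S' = 0) -> z = 0))) => S.
  have [[S' <-]|nS] := pselect (exists S' : {set 'I_q}, phi @: S' = S); last first.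
    by exists 0; split=> // S' SE; case: nS; exists S'.
  have pS := cech_prod_sub S'.
  have [N [z]] := loc_map_coker pS (e' S').
  rewrite expr1n scale1r => zE; exists z; split=> [S'' /(imset_inj phi_inj)->//|].
  move=> /(_ S' erefl) e0; rewrite e0 in zE.
  by have [N' ] := loc_map_ker pS zE; rewrite expr1n scale1r.
exists e; split=> [|S]; last exact: (eE S).2.
by apply: cechP => S; apply: (eE _).1.
Qed.

(** Cocycles are restricted, primitives extended, and the resulting identity is checked through the
    injective maps [loc_map 1]. *)
Lemma almost_acyclic_sub (K : realType) (v : T -> \bar K) p :
  almost_zero v (cech_cohomology x' M p) ->
  almost_acyclic x M v (phi @: [set: 'I_q]) p.
Proof.
move=> az c cp dc.
have phiT (S : {set 'I_q}) : phi @: S \subset phi @: [set: 'I_q] by apply: imsetS; apply: subsetT.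
have cp' : cech_deg p (cech_restr c).
  move=> S Sp; rewrite /cech_restr cp ?(loc_map0 _ (cech_prod_sub S)) //.
  by rewrite (card_imset _ phi_inj).
have dc' : cech_d (cech_restr c) = 0.
  apply: cechP => S; rewrite cech_restr_d dc ?phiT //.
  exact: (loc_map0 _ (cech_prod_sub S)).
apply: almost_mono (almost_zero_cohomology az cp' dc') => b [e' [ep' eE']].
have [e [eR e0]] := cech_extend e'; exists e; split=> [S Sp|S Sphi].
  apply: e0 => S' SE; apply: ep'.
  by rewrite -(card_imset _ phi_inj) SE.
have [S' SE] : exists S' : {set 'I_q}, S = phi @: S'.
  exists (phi @^-1: S); apply/setP => k; apply/idP/imsetP => [kS|[i]].
    have /imsetP[i _ kE] := subsetP Sphi k kS.
    by exists i; rewrite // inE -kE.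
  by rewrite inE => iS ->.
rewrite {S Sphi}SE; have pS := cech_prod_sub S'.
apply/eqP; rewrite -subr_eq0; apply/eqP.
have [|N] := loc_map_ker pS (z := b *: c (phi @: S') - cech_d e (phi @: S')).
  rewrite (loc_mapB pS) (loc_mapZ pS) -cech_restr_d eR -eE'.
  by rewrite cechZ subrr.
by rewrite expr1n scale1r.
Qed.

End Subfamily.

(** * Concatenation of two generating sets and conclusion *)

Lemma generates_mem (R : comNzRingType) (I : {pred R}) (r : nat) (x : 'I_r -> R) i :
  generates x I -> x i \in I.
Proof.
move=> gx; apply/gx; exists (fun j => (j == i)%:R).
by rewrite (bigD1 i) //= eqxx mul1r big1 ?addr0 // => j /negPf->; rewrite mul0r.
Qed.

Theorem corollary3p7 (K : realType) (R : comNzRingType) (m : idealr R)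
    (T : comPzRingType) (f : {rmorphism R -> T}) (v : T -> \bar K)
    (M : lmodType T) (r : nat) (x : 'I_r -> R) :
  noetherian R -> local_ring m -> value_map v ->
  almost_cohen_macaulay f m v M ->
  generates x m ->
  ~ almost_zero v (cech_cohomology (f \o x) M (krull_dim R)).
Proof.
move=> _ _ vv [[s [y [gy azy]]] naz] gx azx; apply: naz.
pose z0 (k : 'I_(r + s)) := match split k with inl i => x i | inr j => y j end.
pose z := f \o z0.
have zm k : z0 k \in m.
  by rewrite /z0; case: split => i; apply: generates_mem.
have xE i : (f \o x) i = z (lshift s i).
  by rewrite /z /z0 /= -[lshift s i]/(unsplit (inl i)) unsplitK.
have yE j : (f \o y) j = z (rshift r j).
  by rewrite /z /z0 /= -[rshift r j]/(unsplit (inr j)) unsplitK.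
have span (q : nat) (w : 'I_q -> R) (phi : 'I_q -> 'I_(r + s)) :
    injective phi -> (forall i, (f \o w) i = z (phi i)) -> generates w m ->
    forall h, exists a : 'I_(r + s) -> T,
      z h = \sum_(i in phi @: [set: 'I_q]) a i * z i.
  move=> phi_inj wE gw h; have /gw[c cE] := zm h.
  (* This is [f (c i)] at [phi i] and 0 off the image, as [phi] is injective. *)
  exists (fun k => \sum_(i | phi i == k) f (c i)).
  rewrite big_imset /=; last by move=> i j _ _ /phi_inj.
  rewrite /z /= cE rmorph_sum; apply: eq_big => [i|i _]; first by rewrite inE.
  rewrite rmorphM; congr (_ * _); last exact: wE.
  rewrite (bigD1 i) //= big1 ?addr0 // => j /andP[/eqP/phi_inj->].
  by rewrite eqxx.
have acyclic p : almost_acyclic z M v [set: 'I_(r + s)] p.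
  have [->|/azy azp] := pselect (p = krull_dim R).
    apply: (almost_acyclicT (span _ _ _ (@lshift_inj _ _) xE gx)).
    by apply: (almost_acyclic_sub _ xE azx).
  apply: (almost_acyclicT (span _ _ _ (@rshift_inj _ _) yE gy)).
  by apply: (almost_acyclic_sub _ yE azp) => i j; rewrite /= ltn_add2l.
have lc := almost_lincomb vv (almost_exact vv acyclic).
elim/quotW => n eps eps0.
have [b [[w bn] vb]] := lc n eps eps0.
exists b; split=> //; apply/quotmod_scale_eq0/asboolP.
by exists (r + s)%N, z0, w.
Qed.
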